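(* Assume $2^{\aleph_0}=\aleph_1$ and $2^{\aleph_1}=\aleph_2$. Then there exists a regular topological space $Y$ which is a $P$-space and which is not weakly discretely generated.
   Context: A topological space is regular if it is $T_1$ and, for every closed set $F$ and every point $x \notin F$, there are disjoint open sets containing $x$ and $F$ respectively. A $P$-space is a topological space in which every $G_\delta$ subset (that is, every intersection of countably many open sets) is open. A subset $D$ of a topological space is called discrete if it is discrete in the subspace topology, i.e. for every $d\in D$ there is an open set $U$ with $U\cap D=\{d\}$ (such a $D$ need not be closed). A topological space $Y$ is weakly discretely generated if for every non-closed set $A \subset Y$ there is a discrete set $D \subset A$ such that $\overline{D} \setminus A \neq \emptyset$, where $\overline{D}$ is the closure of $D$ in $Y$. The underlying set theory is ZFC. *)

(* Defs.v *)
From mathcomp Require Import all_boot all_order.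
From mathcomp Require Import boolp classical_sets functions cardinality.
From mathcomp Require Import topology separation_axioms urysohn borel_hierarchy.

Set Implicit Arguments.
Unset Strict Implicit.
Unset Printing Implicit Defensive.

Local Open Scope classical_set_scope.
Local Open Scope card_scope.

Definition card_lt {T U : Type} (A : set T) (B : set U) : Prop :=
  (A #<= B) /\ ~ (B #<= A).

(* |B| is the least cardinal greater than |A|. Letting C range only over the
   sets of elements of U loses nothing: every cardinal below |B| is the
   cardinal of a subset of B. *)
Definition card_succ {T U : Type} (A : set T) (B : set U) : Prop :=
  card_lt A B /\ forall C : set U, card_lt A C -> (B #<= C).

(* |A| = aleph_n, by aleph_0 = |nat| and aleph_(n+1) = (aleph_n)^+. The witness
   of cardinality aleph_n may be taken in the carrier of A: a set of cardinality
   aleph_(n+1) has a subset of cardinality aleph_n. *)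
Fixpoint has_card_aleph (n : nat) {T : Type} (A : set T) : Prop :=
  match n with
  | 0 => A #= [set: nat]
  | m.+1 => exists2 B : set T, has_card_aleph m B & card_succ B A
  end.

(* The library's [regular_space] does not include T1; see [regular_T1P]. *)
Definition regular_T1 (Y : topologicalType) : Prop :=
  accessible_space Y /\
  forall (F : set Y) (x : Y), closed F -> ~ F x ->
    exists U V : set Y, [/\ open U, open V, U x, F `<=` V & U `&` V = set0].

Lemma regular_T1P (Y : topologicalType) :
  regular_T1 Y <-> accessible_space Y /\ regular_space Y.
Proof.
split=> -[acc reg]; split=> //.
- move=> x; apply/regular_openP => A cA nAx.
  by have [U [V [oU oV Ux AV UV]]] := reg A x cA nAx; exists U, V.
- move=> F x cF nFx.
  by have [U [V [oU oV Ux AV UV]]] := (regular_openP x).1 (reg x) F cF nFx; exists U, V.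
Qed.

Definition P_space (Y : topologicalType) : Prop :=
  forall S : set Y, Gdelta S -> open S.

Definition discrete_subset {Y : topologicalType} (D : set Y) : Prop :=
  forall d, D d -> exists2 U : set Y, open U & U `&` D = [set d].

Definition weakly_discretely_generated (Y : topologicalType) : Prop :=
  forall A : set Y, ~ closed A ->
    exists D : set Y,
      [/\ D `<=` A, discrete_subset D & closure D `\` A !=set0].

(* Main.v *)
Require Import Defs.
From Stdlib Require Inverse_Image.
From HB Require Import structures.
From mathcomp Require Import all_boot all_order.
From mathcomp Require Import boolp classical_sets functions cardinality.
From mathcomp Require Import wochoice topology.

(* Let W have cardinality aleph_1, and let a condition be a countable partial
   function from W to bool. The space is W * 2^W, where each slice {b} * 2^W is
   clopen and carries the topology of agreement on countable sets, plus one
   limit point. Fine and Gillman's construction of remote points under CH,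
   carried one cardinal up, gives the neighbourhoods of the limit point: a
   recursion of length aleph_2 builds functions g_i from W to conditions, where
   each g_i extends all the earlier ones at all but countably many b, such that
   every dense set of conditions contains g_i b for some i and all b. Since
   countably many g_i are compatible at all but countably many b, the sets
   {(b, y) | y extends g_i b} generate a countably complete filter. A discrete
   set is nowhere dense in the slices, so some such neighbourhood misses it,
   although the limit point is in the closure of the union of the slices. *)

Set Implicit Arguments.
Unset Strict Implicit.
Unset Printing Implicit Defensive.

Local Open Scope classical_set_scope.
Local Open Scope card_scope.

(** * Cardinals *)

Lemma card_le_rel {T U : Type} (A : set T) (B : set U) (R : T -> U -> Prop) :
  (forall x, A x -> exists2 y, B y & R x y) ->
  (forall x x' y, A x -> A x' -> R x y -> R x' y -> x = x') -> A #<= B.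
Proof.
move=> RAB Rinj; elim/Ppointed: U => U in B R RAB Rinj *.
  suff -> : A = set0 by [].
  by rewrite -subset0 => x /RAB[y]; rewrite emptyE.
apply/pcard_leP/injfunPex.
have /choice[f fP] : forall x, exists y, A x -> B y /\ R x y.
  by move=> x; have [/RAB[y]|nAx] := pselect (A x); [exists y|exists point].
exists f => [x /fP[]//|x y /set_mem Ax /set_mem Ay fxy].
apply: (Rinj _ _ (f x)) => //; first by case: (fP _ Ax).
by rewrite fxy; case: (fP _ Ay).
Qed.

Lemma card_le_fun {T U : Type} (A : set T) (B : set U) : A !=set0 -> A #<= B ->
  exists f : T -> U,
    (forall x, A x -> B (f x)) /\ forall x y, A x -> A y -> f x = f y -> x = y.
Proof.
move=> [a Aa] AB; elim/Ppointed: U => U in B AB *.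
  by move: AB Aa; rewrite card_le_emptyr => /eqP ->.
have /injfunPex[f fAB fI] := elimT pcard_leP AB.
by exists f; split=> [//|x y Ax Ay]; apply: fI; rewrite inE.
Qed.

(** Zorn's lemma gives a maximal graph of a partial injection from [A] to [B]; if it missed a point
    on each side, adding that pair would enlarge it. *)
Lemma card_le_total {T U : Type} (A : set T) (B : set U) : A #<= B \/ B #<= A.
Proof.
pose P (G : set (T * U)) := [/\ G `<=` A `*` B,
  forall x x' y, G (x, y) -> G (x', y) -> x = x' &
  forall x y y', G (x, y) -> G (x, y') -> y = y'].
have [F FP totF|G [[GAB Gl Gr] Gmax]] := @Zorn_bigcup _ P.
  have dir p q : (\bigcup_(X in F) X) p -> (\bigcup_(X in F) X) q ->
      exists X, [/\ P X, X p & X q].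
    move=> [X FX Xp] [Z FZ Zq].
    by have [XZ|ZX] := totF _ _ FX FZ;
      [exists Z|exists X]; split; [exact: FP|auto|auto|exact: FP|auto|auto].
  split=> [p [X FX]|x x' y p q|x y y' p q].
  - by have [+ _ _] := FP _ FX; apply.
  - by have [X [[_ + _] Xp Xq]] := dir _ _ p q; apply; [exact: Xp|exact: Xq].
  - by have [X [[_ _ +] Xp Xq]] := dir _ _ p q; apply; [exact: Xp|exact: Xq].
have [AG|/existsNP[x /not_implyP[Ax nGx]]] :=
    pselect (forall x, A x -> exists y, G (x, y)).
  left; apply: (@card_le_rel _ _ _ _ (fun x y => G (x, y))) => [x /AG[y Gxy]|].
    by exists y => //; case: (GAB _ Gxy).
  by move=> x x' y _ _; exact: Gl.
have [BG|/existsNP[y /not_implyP[By nGy]]] :=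
    pselect (forall y, B y -> exists x, G (x, y)).
  right; apply: (@card_le_rel _ _ _ _ (fun y x => G (x, y))) => [y /BG[x' Gxy]|].
    by exists x' => //; case: (GAB _ Gxy).
  by move=> y y' x' _ _; exact: Gr.
exfalso; apply: (Gmax (G `|` [set (x, y)])).
  split=> [p|/(_ (x, y) (or_intror erefl)) Gxy]; first by left.
  by apply: nGx; exists y.
split.
- by move=> _ [/GAB//|->].
- move=> u u' v [Guv|[-> ->]] [Gu'v|[]]; [exact: Gl Gu'v| | |by []].
  + by move=> _ vy; case: nGy; exists u; rewrite -vy.
  + by case: nGy; exists u'.
- move=> u v v' [Guv|[-> ->]] [Guv'|[]]; [exact: Gr Guv'| | |by []].
  + by move=> ux _; case: nGx; exists v; rewrite -ux.
  + by case: nGx; exists v'.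
Qed.

Definition wf_total {T : Type} (R : T -> T -> Prop) :=
  well_founded R /\ forall x y, [\/ R x y, x = y | R y x].

Lemma wf_total_exists (T : Type) : exists R : T -> T -> Prop, wf_total R.
Proof.
have [R woR] := well_ordering_principle {classic T}.
pose lt (x y : T) := R x y /\ x <> y.
have Rmin (A : set T) : A !=set0 ->
    exists2 a, A a & forall x, A x -> x = a \/ lt a x.
  move=> [a Aa]; have [|z [[zA zmin] _]] := woR [pred x | `[< A x >]].
    by exists a; apply/asboolP.
  exists z => [|x Ax]; first exact/asboolP.
  have [->|xz] := pselect (x = z); [by left|right; split; last exact/nesym].
  by apply: zmin; apply/asboolP.
have antiR : antisymmetric R.
  by move=> x y; apply: (wo_chain_antisymmetric (withinW woR)).
exists lt; split=> [x|x y].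
  apply: contrapT => nx.
  have [z nz zmin] := Rmin [set x | ~ Acc lt x] (ex_intro _ x nx).
  apply: nz; constructor => y [Ryz nyz]; apply: contrapT => /zmin[//|[Rzy _]].
  by apply: nyz; apply: antiR; rewrite Ryz Rzy.
have [|z] := Rmin [set x; y]; first by exists x; left.
move=> [->|->] zmin.
  by have [->|] := zmin y (or_intror erefl); [constructor 2|constructor 1].
by have [->|] := zmin x (or_introl erefl); [constructor 2|constructor 3].
Qed.

(* Pulling an arbitrary well-order back along an injection into its first
   initial segment above the cardinal of [B] makes every segment small. *)
Lemma card_succ_wf {T U : Type} (B : set U) : card_succ B [set: T] ->
  exists R : T -> T -> Prop, wf_total R /\ forall a, [set x | R x a] #<= B.
Proof.
move=> [[_ TB] Bsucc].
have [R [wfR totR]] := wf_total_exists T.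
have [|/existsNP[a0 na0]] := pselect (forall a, [set x | R x a] #<= B).
  by move=> segB; exists R.
have [a na amin] : exists2 a, ~ ([set x | R x a] #<= B) &
    forall b, R b a -> [set x | R x b] #<= B.
  elim/(well_founded_ind wfR): a0 na0 => a IH na.
  have [|/existsNP[b /not_implyP[ba /(IH _ ba)//]]] :=
    pselect (forall b, R b a -> [set x | R x b] #<= B).
  by exists a.
have TJ : [set: T] #<= [set x | R x a].
  by apply: Bsucc; split=> //; case: (card_le_total B [set x | R x a]).
have [f [fJ finj]] := card_le_fun (ex_intro _ a I : [set: T] !=set0) TJ.
exists (fun x y => R (f x) (f y)); split; first split.
- exact: (Inverse_Image.wf_inverse_image T T R f wfR).
- move=> x y; have [|/finj ->//|] := totR (f x) (f y);
    by [constructor 1|constructor 2|constructor 3].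
- move=> b; apply: card_le_trans (amin (f b) (fJ b I)).
  apply: (@card_le_rel _ _ _ _ (fun x y => f x = y)) => [x|].
    by exists (f x).
  by move=> x x' y _ _ <- /finj->.
Qed.

(** If [B] injects into [A], its image there is larger than [A0], so minimality of [A] applies. The
    image is taken because [card_succ] ranges over subsets of the carrier of [A]. *)
Lemma has_card_aleph1_le {T U : Type} (A : set T) (B : set U) :
  has_card_aleph 1 A -> has_card_aleph 1 B -> A #<= B.
Proof.
move=> [A0 /= A0N [_ A0succ]] [B0 /= B0N [[B0B BB0] _]].
have [//|BA] := card_le_total A B.
have [B_0|/set0P Bn0] := eqVneq B set0.
  by exfalso; apply: BB0; rewrite B_0.
have [f [fA finj]] := card_le_fun Bn0 BA.
have fB : f @` B #= B.
  by apply: inj_card_eq => x y /set_mem ? /set_mem ?; exact: finj.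
have A0B0 : A0 #= B0 by apply: card_eq_trans A0N _; rewrite card_eq_sym.
rewrite -(card_le_eqr fB); apply: A0succ; split.
  by rewrite (card_le_eqr fB) (card_le_eql A0B0).
by rewrite (card_le_eql fB) (card_le_eqr A0B0).
Qed.
(** * The tower of functions into conditions *)

(** Well-founded recursion with choice, where a stage sees only the set of earlier values. The
    conclusion is conditional: that a step exists may depend on the earlier stages being good, which
    a later induction settles. *)
Lemma wf_choice (I H : Type) (R : I -> I -> Prop)
    (step : I -> set H -> H -> Prop) :
  H -> well_founded R ->
  exists h : I -> H, forall i, let past := h @` [set j | R j i] in
    (exists g, step i past g) -> step i past (h i).
Proof.
move=> h0 wfR.
have /choice[c cP] : forall p : I * set H,
    exists g, (exists g, step p.1 p.2 g) -> step p.1 p.2 g.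
  by move=> p; have [[g]|] := pselect (exists g, step p.1 p.2 g);
    [exists g|exists h0].
pose F i (rec : forall j, R j i -> H) :=
  c (i, [set g | exists j (r : R j i), g = rec j r]).
exists (Fix wfR (fun=> H) F) => i /=.
rewrite Fix_eq; last first.
  move=> {}i f f' ff'; congr (F i).
  by apply: functional_extensionality_dep => j; apply/funext.
rewrite /F.
set P := image _ _.
suff -> : [set g | exists j, exists _ : R j i, g = Fix wfR (fun=> H) F j] = P.
  exact: (cP (i, P)).
apply/seteqP; split=> g [j]; first by move=> [r ->]; exists j.
by move=> r <-; exists j, r.
Qed.

Lemma countableU {T : Type} (A B : set T) :
  countable A -> countable B -> countable (A `|` B).
Proof.
by move=> cA cB; rewrite -bigcup2E; apply: bigcup_countable => // -[|[|n]] _.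
Qed.

Definition almost {W : Type} (P : W -> Prop) := countable [set b | ~ P b].

Lemma almost_sub {W : Type} (P Q : W -> Prop) :
  (forall b, P b -> Q b) -> almost P -> almost Q.
Proof.
move=> PQ; apply: sub_countable; apply: subset_card_le => b.
by apply: contra_not; exact: PQ.
Qed.

Lemma almostT {W : Type} (P : W -> Prop) : (forall b, P b) -> almost P.
Proof.
move=> aP; apply: sub_countable (countable0 W).
by apply: subset_card_le => b; apply.
Qed.

Lemma almost_all {W I : Type} (A : set I) (P : I -> W -> Prop) :
  countable A -> (forall i, A i -> almost (P i)) ->
  almost (fun b => forall i, A i -> P i b).
Proof.
move=> cA aP; have := bigcup_countable cA aP; apply: sub_countable.
apply: subset_card_le => b /= /existsNP[i /not_implyP[Ai nP]].
by exists i.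
Qed.

Lemma almostI {W : Type} (P Q : W -> Prop) :
  almost P -> almost Q -> almost (fun b => P b /\ Q b).
Proof.
move=> aP aQ; apply: sub_countable (countableU aP aQ).
apply: subset_card_le => b /=.
by rewrite not_andE.
Qed.

(** [compat t t] says that [t] is the graph of a partial function. *)
Definition compat {W : Type} (s t : set (W * bool)) :=
  forall w b b', s (w, b) -> t (w, b') -> b = b'.

Definition cond {W : Type} (t : set (W * bool)) := countable t /\ compat t t.

Definition dense_conds {W : Type} (E : W -> set (set (W * bool))) :=
  forall b s, cond s -> exists t, [/\ s `<=` t, cond t & E b t].

Section Tower.
Context {W : Type} (R : W -> W -> Prop).
Hypothesis Rwf : wf_total R.
Hypothesis Rseg : forall a, countable [set x | R x a].
Implicit Types (A : set (W -> set (W * bool))) (E : W -> set (set (W * bool))).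

(* Index A by W through e. At b, take the union of those g with e g < b such
   that all members of A of index at most e g are pairwise compatible at b:
   each g in A is included for all but countably many b. *)
Lemma fusion A E : A #<= [set: W] ->
  (forall g b, A g -> countable (g b)) ->
  (forall g g', A g -> A g' -> almost (fun b => compat (g b) (g' b))) ->
  dense_conds E ->
  exists g, (forall b, cond (g b) /\ E b (g b)) /\
    forall g', A g' -> almost (fun b => g' b `<=` g b).
Proof.
move=> AW Ac Acompat dE.
have [A0|/set0P An0] := eqVneq A set0.
  have /choice[g gP] : forall b, exists t, cond t /\ E b t.
    move=> b; have [|t [_ ct Et]] := dE b set0; last by exists t.
    by split=> // w ? ? [].
  by exists g; split=> // g'; rewrite A0.
have [e [_ einj]] := card_le_fun An0 AW.
pose le (x y : W) := R x y \/ x = y.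
have le_total x y : le x y \/ le y x.
  by have [_ /(_ x y)[]] := Rwf; [left; left|left; right|right; left].
have lec y : countable [set x | le x y].
  exact: countableU (Rseg y) (countable1 y).
pose L g := [set g' | A g' /\ le (e g') (e g)].
have Lc g : countable (L g).
  apply: sub_countable (lec (e g)).
  apply: (@card_le_rel _ _ _ _ (fun g' x => e g' = x)) => [g' [_ le_g]|].
    by exists (e g').
  by move=> x x' y [Ax _] [Ax' _] <- /esym; exact: einj.
pose G b := [set g | [/\ A g, R (e g) b &
  forall g', L g g' -> forall g'', L g g'' -> compat (g' b) (g'' b)]].
have Gc b : countable (G b).
  apply: sub_countable (Rseg b).
  apply: (@card_le_rel _ _ _ _ (fun g' x => e g' = x)) => [g' []|].
    by exists (e g').
  by move=> x x' y [Ax _ _] [Ax' _ _] <- /esym; exact: einj.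
pose t b := \bigcup_(g in G b) g b.
have tcond b : cond (t b).
  split; first by apply: bigcup_countable => // g [Ag _ _]; exact: Ac.
  (* Of two members of [G b], the one of larger index has both in its [L], so its own clause makes
     them compatible at [b]. *)
  move=> w v v' [g [Ag eg gP] gw] [g' [Ag' eg' gP'] gw'].
  have [le_g|le_g] := le_total (e g) (e g').
    by apply: (gP' g _ g') gw gw'; split=> //; right.
  by apply: (gP g _ g') gw gw'; split=> //; right.
have /choice[h hP] := fun b => dE b _ (tcond b).
exists h; split=> [b|g Ag]; first by have [] := hP b.
suff : almost (G^~ g).
  by apply: almost_sub => b Gg p gp; have [+ _ _] := hP b; apply; exists g.
(* The first clause fails only for [b] at or below [e g], the second only on a countable union over
   pairs from [L g]. *)
have : almost (fun b => R (e g) b /\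
    forall g', L g g' -> forall g'', L g g'' -> compat (g' b) (g'' b)).
  apply: almostI.
    apply: sub_countable (lec (e g)); apply: subset_card_le => b /= nR.
    by have [_ /(_ b (e g))[]] := Rwf; [left|right|].
  apply: almost_all => // g' [Ag' _]; apply: almost_all => // g'' [Ag'' _].
  exact: Acompat.
by apply: almost_sub => b [].
Qed.

(** Stage [i] applies [fusion] to the earlier values, whose compatibility comes from the induction:
    of two stages, the later takes conditions as values and extends the earlier almost
    everywhere. *)
Lemma generic_tower {I : Type} (S : I -> I -> Prop)
    (E : I -> W -> set (set (W * bool))) :
  wf_total S -> (forall i, [set j | S j i] #<= [set: W]) ->
  (forall i, dense_conds (E i)) ->
  exists h : I -> W -> set (W * bool),
    (forall i b, cond (h i b) /\ E i b (h i b)) /\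
    forall i j, almost (fun b => compat (h i b) (h j b)).
Proof.
move=> [wfS totS] Sseg dE.
pose step i A (g : W -> set (W * bool)) :=
    (forall b, cond (g b) /\ E i b (g b)) /\
    forall g', A g' -> almost (fun b => g' b `<=` g b).
have [h hP] := wf_choice step (fun=> set0) wfS.
have compath i : (forall b, cond (h i b)) ->
    almost (fun b => compat (h i b) (h i b)).
  by move=> ci; apply: almostT => b; case: (ci b).
have compatS i j : step i (h @` [set j | S j i]) (h i) -> S j i ->
    almost (fun b => compat (h j b) (h i b)).
  move=> [ci hi] Sji; have : almost (fun b => h j b `<=` h i b).
    by apply: hi; exists j.
  apply: almost_sub => b hji w v v' /hji; have [[_ c] _] := ci b; exact: c.
have compatC i j : almost (fun b => compat (h j b) (h i b)) ->
    almost (fun b => compat (h i b) (h j b)).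
  by apply: almost_sub => b c w v v' /[swap] /c/[apply].
have compat2 i j : step i (h @` [set j | S j i]) (h i) ->
    step j (h @` [set i | S i j]) (h j) ->
    almost (fun b => compat (h i b) (h j b)).
  move=> si sj; have [Sij| ->|Sji] := totS i j; first exact: compatS.
    by apply: compath => b; have [/(_ b)[]] := sj.
  by apply: compatC; exact: compatS.
suff stepP i : step i (h @` [set j | S j i]) (h i).
  by exists h; split=> [i|i j]; [have [] := stepP i|exact: compat2].
elim/(well_founded_ind wfS): i => i IH; apply: hP; apply: fusion => //.
- exact: card_le_trans (card_image_le _ _) (Sseg i).
- by move=> _ b [j /IH[cj _] <-]; have [[]] := cj b.
- by move=> _ _ [j Sj <-] [k Sk <-]; apply: compat2; exact: IH.
Qed.

End Tower.

(** * Coding dense families of conditions by sets of sets of naturals *)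

Lemma cond_range {W : Type} (t : set (W * bool)) :
  t !=set0 -> cond t -> exists u : nat -> W * bool, t = range u.
Proof.
move=> t0 [ct _]; have [t0'|[f]] := elimT pfcard_geP ct.
  by rewrite t0' in t0; case: t0.
by apply/surjfunPex; squash f.
Qed.

(** The tagged disjoint union of [b], the sets [(p.2 k).1] and the bits [(p.2 k).2], so that a slice
    index together with an enumerated condition becomes one set of naturals. *)
Definition code (p : set nat * (nat -> set nat * bool)) : set nat :=
  choice.pickle @` [set c : nat + nat * nat + nat | match c with
    | inl (inl n) => p.1 n
    | inl (inr (k, n)) => (p.2 k).1 n
    | inr k => (p.2 k).2
    end].

Lemma code_inj : injective code.
Proof.
move=> p q pq.
have pqE (c : nat + nat * nat + nat) :
    code p (choice.pickle c) = code q (choice.pickle c) by rewrite pq.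
have codeE r c : code r (choice.pickle c) = match c with
    | inl (inl n) => r.1 n
    | inl (inr (k, n)) => (r.2 k).1 n
    | inr k => (r.2 k).2
    end.
  rewrite propeqE; split; last by exists c.
  by move=> [c' + /(pcan_inj choice.pickleK) <-].
case: p q {pq} pqE => [p1 p2] [q1 q2] pqE; congr pair.
  by apply/seteqP; split=> n; have := pqE (inl (inl n)); rewrite !codeE /= => ->.
apply/funext => k; have := pqE (inr k); rewrite !codeE /= => vw.
have xy n : (p2 k).1 n = (q2 k).1 n.
  by have := pqE (inl (inr (k, n))); rewrite !codeE.
case: (p2 k) (q2 k) vw xy => [x v] [y w] /= vw xy.
congr pair; last by apply/idP/idP; rewrite vw.
by apply/seteqP; split=> n; rewrite xy.
Qed.

(** By the two cardinal hypotheses, the codes [X] of dense families are well-ordered with segments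
    of size at most aleph_1, and [set nat] with countable segments, as [generic_tower] requires. *)
Lemma generic_family :
  has_card_aleph 1 [set: set nat] -> has_card_aleph 2 [set: set (set nat)] ->
  exists H : set (set nat -> set (set nat * bool)),
    [/\ forall g b, H g -> cond (g b),
        forall g g', H g -> H g' -> almost (fun b => compat (g b) (g' b)) &
        forall E, dense_conds E -> exists2 g, H g & forall b, E b (g b)].
Proof.
move=> aleph1 [B B1 /card_succ_wf[S [Swf Sseg]]].
have {}Sseg i : [set j | S j i] #<= [set: set nat].
  by apply: card_le_trans (Sseg i) _; exact: has_card_aleph1_le.
have [N N0 /card_succ_wf[R [Rwf Rseg]]] := aleph1.
have {}Rseg a : countable [set x | R x a].
  by rewrite /countable -(card_le_eqr N0).
pose D (X : set (set nat)) b t := exists2 u, t = range u & X (code (b, u)).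
(* If [X] codes no dense family, [E X] is everything, so every stage has a dense requirement. *)
pose E X b t := dense_conds (D X) -> D X b t.
have dE X : dense_conds (E X).
  move=> b s cs; have [dD|nD] := pselect (dense_conds (D X));
    last by exists s; split.
  by have [t [st ct Dt]] := dD b s cs; exists t; split.
have [h [hE hcompat]] := generic_tower Rwf Rseg Swf Sseg dE.
exists (range h); split.
- by move=> _ b [X _ <-]; case: (hE X b).
- by move=> _ _ [X _ <-] [Y _ <-].
move=> F dF; pose X := code @` [set p | F p.1 (range p.2)].
have XF b t : D X b t -> F b t.
  by move=> [u -> [p + /code_inj pE]]; rewrite pE.
have dX : dense_conds (D X).
  move=> b s cs.
  (* The empty condition is not the range of a sequence, so it is first enlarged by an arbitrary
     pair. *)
  have [s' [ss' cs' s'0]] : exists s', [/\ s `<=` s', cond s' & s' !=set0].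
    have [->|/set0P s0] := eqVneq s set0; last by exists s; split.
    exists [set (set0, true)]; split=> //; last by exists (set0, true).
    split; first exact: countable1.
    by move=> w v v' /(congr1 snd)/= -> /(congr1 snd)/= ->.
  have [t [s't ct Ft]] := dF b s' cs'.
  exists t; split=> //; first exact: subset_trans s't.
  have [|u tu] := cond_range _ ct; first by case: s'0 => p /s't; exists p.
  by exists u => //; exists (b, u) => //=; rewrite -tu.
exists (h X); first by exists X.
by move=> b; apply: XF; have [_] := hE X b; apply.
Qed.
(** * Topologies generated by countable intersections *)

Definition sigma_open {T : Type} (B : set (set T)) (U : set T) : Prop :=
  forall x, U x -> exists C : set (set T),
    [/\ countable C, C `<=` B, (\bigcap_(V in C) V) x &
        \bigcap_(V in C) V `<=` U].

(** A copy of [T] that records [B], so that the topology can be attached to it as an instance. *)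
Definition sigma_space {T : Type} (B : set (set T)) : Type := T.

Section SigmaTopology.
Context {T : choiceType} (B : set (set T)).

HB.instance Definition _ := Choice.on (sigma_space B).

Lemma sigma_openT : sigma_open B setT.
Proof. by move=> x _; exists set0; split=> // V []. Qed.

Lemma sigma_open_bigcap (F : nat -> set T) :
  (forall n, sigma_open B (F n)) -> sigma_open B (\bigcap_n F n).
Proof.
move=> oF x Fx.
have /choice[C CP] := fun n => oF n x (Fx n I).
exists (\bigcup_n C n); split.
- by apply: bigcup_countable => // n _; have [] := CP n.
- by move=> V [n _ CV]; have [_ + _ _] := CP n; apply.
- by move=> V [n _ CV]; have [_ _ + _] := CP n; apply.
- move=> y Cy n _; have [_ _ _] := CP n; apply => V CV.
  by apply: Cy; exists n.
Qed.

Lemma sigma_openI : setI_closed (sigma_open B).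
Proof.
move=> U V oU oV; rewrite -bigcap2E; apply: sigma_open_bigcap => -[|[|n]] //=.
exact: sigma_openT.
Qed.

Lemma sigma_open_bigcup (I : Type) (F : I -> set T) :
  (forall i, sigma_open B (F i)) -> sigma_open B (\bigcup_i F i).
Proof.
move=> oF x [i _ /oF[C [cC CB Cx CF]]]; exists C; split=> //.
by move=> y /CF; exists i.
Qed.

HB.instance Definition _ := isOpenTopological.Build (sigma_space B)
  sigma_openT sigma_openI sigma_open_bigcup.

Local Notation Y := (sigma_space B).

Lemma sigma_space_open (U : set Y) : open U = sigma_open B U.
Proof. by []. Qed.

Lemma sigma_space_base (U : set Y) : B U -> open U.
Proof.
rewrite sigma_space_open => BU x Ux; exists [set U].
by split=> [|V ->|V ->|y Uy] //; exact: Uy.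

Qed.

Lemma sigma_space_P : P_space Y.
Proof. by move=> S [F oF ->]; exact: sigma_open_bigcap. Qed.

(** Closure under complements makes each countable intersection from [B] clopen: its complement is a
    union of members of [B]. *)
Lemma sigma_space_regular : (forall U, B U -> B (~` U)) ->
  (forall x y, x <> y -> exists U, [/\ B U, U x & ~ U y]) -> regular_T1 Y.
Proof.
move=> BC Bsep; split.
  move=> x y /eqP/Bsep[U [BU Ux nUy]]; exists U.
  by split; [exact: sigma_space_base|exact/mem_set|exact/mem_set].
move=> F x cF nFx.
have [C [cC CB Cx CF]] : exists C, [/\ countable C, C `<=` B,
    (\bigcap_(V in C) V) x & \bigcap_(V in C) V `<=` ~` F].
  by move: cF; rewrite -openC sigma_space_open; exact.
exists (\bigcap_(V in C) V), (~` \bigcap_(V in C) V); split=> //.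
- by rewrite sigma_space_open => y Cy; exists C; split.
- rewrite sigma_space_open => y; rewrite setC_bigcap => -[V CV nVy].
  exists [set ~` V]; split=> // [_ ->|_ ->//|z nVz]; first exact/BC/CB.
  by exists V => //; exact: nVz.
- by move=> y Fy Cy; exact: CF Fy.
- exact: setICr.
Qed.

End SigmaTopology.

(** * The space *)

Section Space.
Context {W : choiceType} (H : set (W -> set (W * bool))).
Hypothesis Wunc : ~ countable [set: W].
Hypothesis Hcompat :
  forall g g', H g -> H g' -> almost (fun b => compat (g b) (g' b)).
Hypothesis Hcond : forall g b, H g -> cond (g b).
Hypothesis Hgeneric :
  forall E, dense_conds E -> exists2 g, H g & forall b, E b (g b).

Definition extends (y : W -> bool) (t : set (W * bool)) :=
  forall q, t q -> y q.1 = q.2.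

Local Notation point_space := (option (W * (W -> bool))).

(* Confined to one slice, so that a neighbourhood of the limit point None
   constrains only countably many slices through complements of cylinders. *)
Definition cylinder (b w : W) (v : bool) : set point_space :=
  [set p | if p is Some (b', y) then b' = b /\ y w = v else False].

Definition limit_nbhs (g : W -> set (W * bool)) : set point_space :=
  [set p | if p is Some (b, y) then extends y (g b) else True].

Definition half_base : set (set point_space) :=
  [set U | (exists b w v, U = cylinder b w v) \/
           exists2 g, H g & U = limit_nbhs g].

Definition clopen_base := [set U | half_base U \/ half_base (~` U)].

Lemma clopen_baseC U : clopen_base U -> clopen_base (~` U).
Proof. by move=> []; [right; rewrite setCK|left]. Qed.

Local Notation Y := (sigma_space clopen_base).

Lemma almost_exists (P : W -> Prop) : almost P -> exists b, P b.
Proof.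
move=> aP; apply: contrapT => nP; apply: Wunc; apply: sub_countable aP.
by apply: subset_card_le => b _ Pb; apply: nP; exists b.
Qed.

Lemma clopen_base_sep (p q : Y) : p <> q ->
  exists U, [/\ clopen_base U, U p & ~ U q].
Proof.
have [w0 _] : exists w : W, True.
  by apply: almost_exists; exact: almostT.
have sepS b y x : Some (b, y) <> x -> exists w, ~ cylinder b w (y w) x.
  case: x => [[b' y']|] //= neq; last by exists w0.
  have [bb|] := pselect (b' = b); last by exists w0; case.
  apply: contrapT => /forallNP ally; apply: neq; rewrite bb.
  congr (Some (_, _)); apply/funext => w.
  by have /contrapT[] := ally w.
case: p => [[b y]|] pq.
  have [w nw] := sepS _ _ _ pq; exists (cylinder b w (y w)); split=> //.
  by left; left; exists b, w, (y w).
case: q pq => [[b y] _|//]; exists (~` cylinder b w0 (y w0)); split=> //.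
  by right; left; rewrite setCK; exists b, w0, (y w0).
by apply.
Qed.

(** A cylinder depends on one coordinate, and [limit_nbhs g] within slice [b] on the countable
    domain of [g b]; a complement has the same support. *)
Lemma clopen_base_support U (b : W) : clopen_base U ->
  exists2 t : set W, countable t & forall y y',
    (forall w, t w -> y w = y' w) -> U (Some (b, y)) -> U (Some (b, y')).
Proof.
have half V : half_base V -> exists2 t : set W, countable t &
    forall y y', (forall w, t w -> y w = y' w) ->
      V (Some (b, y)) -> V (Some (b, y')).
  move=> [[b' [w [v ->]]]|[g Hg ->]].
    by exists [set w]; [exact: countable1|move=> y y' /(_ w erefl) /= ->].
  exists (fst @` g b).
    by apply: (card_le_trans (card_image_le _ _)); have [] := Hcond b Hg.
  by move=> y y' yy' yg q gq; rewrite -yy' ?yg//; exists q.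
move=> [/half//|/half[t ct tU]]; exists t => // y y' yy' Uy.
by apply: contrapT => /(tU y' y)[|//] w /yy'.
Qed.

Lemma range_Some_not_closed : ~ closed (range Some : set Y).
Proof.
rewrite -openC sigma_space_open => /(_ None)[[x _]//|C [cC CB CN]].
have {CN}CN V : C V -> V None by move=> CV; exact: CN.
(* Each [V] receives conditions [o V b] forcing membership in [V] for almost all [b]. For the
   complement of a cylinder the empty condition does, except in the cylinder's slice. *)
have /choice[o oP] : forall V : set point_space,
    exists g : W -> set (W * bool),
    (H g \/ g = fun=> set0) /\
    (C V -> almost (fun b => forall y, extends y (g b) -> V (Some (b, y)))).
  move=> V; have [CV|nCV] := pselect (C V); last first.
    by exists (fun=> set0); split; [right|].
  have VN := CN _ CV.
  have [[[b [w [v VE]]]|[g Hg VE]]|[[b [w [v VE]]]|[g Hg VE]]] := CB _ CV.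
  - by rewrite VE in VN.
  - exists g; split=> [|_]; first by left.
    by apply: almostT => b y yg; rewrite VE.
  - exists (fun=> set0); split=> [|_]; first by right.
    apply: sub_countable (countable1 b); apply: subset_card_le => b' /= nV.
    apply: contrapT => b'b; apply: nV => y _; apply: contrapT => nVy.
    have : (~` V) (Some (b', y)) by [].
    by rewrite VE /= => -[].
  - by have : (~` V) None by rewrite VE.
have compato V V' : almost (fun b => compat (o V b) (o V' b)).
  have [[HV|->] _] := oP V; last by apply: almostT => b w v v' [].
  have [[HV'|->] _] := oP V'; last by apply: almostT => b w v v' _ [].
  exact: Hcompat.
have [b [bext bcompat]] : exists b,
    (forall V, C V -> forall y, extends y (o V b) -> V (Some (b, y))) /\
    forall V, C V -> forall V', C V' -> compat (o V b) (o V' b).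
  apply: almost_exists; apply: almostI; apply: almost_all => // V CV.
    by have [_] := oP V; apply.
  by apply: almost_all => // V' CV'; exact: compato.
(* A common extension of all [o V b], with value false off their domains. *)
pose y w := `[< exists2 V, C V & o V b (w, true) >].
move=> /(_ (Some (b, y))); apply; last by exists (b, y).
move=> V CV; apply: bext => // -[w []] ow /=; first by apply/asboolP; exists V.
apply/asboolP => -[V' CV' ow'].
by have := bcompat _ CV _ CV' _ _ _ ow ow'.
Qed.

(** Otherwise [D] meets every condition above [s]. A neighbourhood isolating some [y] depends on
    countably many coordinates of the slice; fixing [y] on these and flipping it at another one
    yields a second point of [D] in that neighbourhood. *)
Lemma discrete_nowhere_dense (D : set Y) : discrete_subset D ->
  dense_conds (fun b t => forall y, extends y t -> ~ D (Some (b, y))).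
Proof.
move=> discD b s cs; apply: contrapT => /forallNP nE.
have meetD t : s `<=` t -> cond t -> exists2 y, extends y t & D (Some (b, y)).
  move=> st ct; apply: contrapT => /forall2NP nD.
  apply: (nE t); split=> // y yt Dy.
  by case: (nD y).
have [y ys Dy] := meetD s (fun q => id) cs.
have [U + UD] := discD _ Dy; rewrite sigma_space_open.
have Uy : U (Some (b, y)) by have [] : (U `&` D) (Some (b, y)) by rewrite UD.
move=> /(_ _ Uy)[C [cC CB Cy CU]].
have /choice[tau tauP] : forall V : set point_space,
    exists t : set W, C V -> countable t /\
    forall y y', (forall w, t w -> y w = y' w) ->
      V (Some (b, y)) -> V (Some (b, y')).
  move=> V; have [CV|] := pselect (C V); last by exists set0.
  by have [t ct tV] := clopen_base_support b (CB _ CV); exists t.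
pose X := fst @` s `|` \bigcup_(V in C) tau V.
have cX : countable X.
  apply: countableU.
    by apply: (card_le_trans (card_image_le _ _)); case: cs.
  by apply: bigcup_countable => // V /tauP[].
have [w0 nXw0] : exists w0, ~ X w0.
  apply: almost_exists; apply: sub_countable cX.
  by apply: subset_card_le => w; exact: contrapT.
pose y' w := if w == w0 then ~~ y w0 else y w.
have y'X w : X w -> y' w = y w.
  by rewrite /y'; case: eqP => // ->.
pose t := (fun w => (w, y' w)) @` ([set w0] `|` X).
have [||y'' y''t Dy''] := meetD t.
- move=> [w v] swv.
  have Xw : X w by left; exists (w, v).
  by exists w; [right|rewrite y'X ?(ys _ swv)].
- split; last by move=> w v v' [w1 _ [<- <-]] [w2 _ [-> ->]].
  apply: (card_le_trans (card_image_le _ _)).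
  by apply: countableU => //; exact: countable1.
have y''X w : X w -> y w = y'' w.
  by move=> Xw; rewrite -y'X// (y''t (w, y' w))//; exists w => //; right.
have : (U `&` D) (Some (b, y'')).
  split=> //; apply: CU => V CV; have [_ tV] := tauP _ CV.
  by apply: tV (Cy _ CV) => w tw; apply: y''X; right; exists V.
rewrite UD => -[yy''].
have : y'' w0 = y' w0 by apply: (y''t (w0, y' w0)); exists w0 => //; left.
by rewrite yy'' /y' eqxx; case: (y w0).
Qed.

Lemma not_weakly_discretely_generated : ~ weakly_discretely_generated Y.
Proof.
move=> /(_ _ range_Some_not_closed)[D [DS discD [p [clp nSp]]]].
have {nSp}pN : p = None by case: p nSp {clp} => // x []; exists x.
have [g Hg gD] := Hgeneric (discrete_nowhere_dense discD).
have [|x [Dx]] := clp (limit_nbhs g).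
  rewrite pN; apply: open_nbhs_nbhs; split=> //; apply: sigma_space_base.
  by left; right; exists g.
have [[b y] _ xE] := DS _ Dx; rewrite -xE in Dx *.
by move=> /gD.
Qed.

End Space.

Theorem theorem1
    (two_aleph0 : has_card_aleph 1 [set: set nat])
    (two_aleph1 : forall T : Type,
      has_card_aleph 1 [set: T] -> has_card_aleph 2 [set: set T]) :
  exists Y : topologicalType,
    [/\ regular_T1 Y, P_space Y & ~ weakly_discretely_generated Y].
Proof.
have uncount : ~ countable [set: set nat].
  by have [N N0 [[_ +] _]] := two_aleph0; rewrite (card_le_eqr N0).
have [H [Hcond Hcompat Hgen]] :=
  (* The index set [W] is [set nat], of size aleph_1 by the first hypothesis. *)
  generic_family two_aleph0 (two_aleph1 _ two_aleph0).
exists (sigma_space (clopen_base H)); split.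
- by apply: sigma_space_regular; [exact: clopen_baseC|exact: clopen_base_sep].
- exact: sigma_space_P.
- exact: not_weakly_discretely_generated.
Qed.
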